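(* Each analytic quasi-order $R$ on a standard Borel space $X$ is Borel equivalent to a quasi-order on ${}^\omega 2$ induced by a closed action of the monoid $S^-_\infty$. Moreover, $R$ itself is induced by a Borel action of $S^-_\infty$.
   Context: $S^-_\infty$ is the Polish monoid of all injective (not necessarily surjective) functions $\omega\to\omega$, with composition and identity, topologized as a subspace of the Baire space ${}^\omega\omega$. An action of a Polish monoid $G$ (identity $e$) on a Polish (or standard Borel) space $Y$ is a relation $A\subseteq G\times Y\times Y$ such that for all $x,y,z\in Y$, $g,h\in G$: (i) $(e,x,x)\in A$; (ii) if $(h,x,y)\in A$ and $(g,y,z)\in A$ then $(gh,x,z)\in A$. The action is closed (Borel) if $A$ is closed (Borel) in $G\times Y\times Y$. The quasi-order induced by $A$ is $x\,E^{G,A}_Y\,y\iff\exists g\in G\,((g,x,y)\in A)$. $R\le_B R'$ means there is a Borel $f$ with $xRy\iff f(x)R'f(y)$; Borel equivalent means reducible in both directions. *)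

(* Defs.v *)
From HB Require Import structures.
From Corelib Require Export RelationClasses.
From mathcomp Require Export all_boot all_order all_algebra.
From mathcomp Require Export all_classical all_reals all_analysis.

Set Implicit Arguments.
Unset Strict Implicit.
Unset Printing Implicit Defensive.

Local Open Scope classical_set_scope.

(* The product of the discrete topologies on nat. *)
Definition baire_space : Type := prod_topology (fun _ : nat => nat).

HB.instance Definition _ := Pointed.on baire_space.
HB.instance Definition _ := Nbhs.on baire_space.
HB.instance Definition _ := Topological.on baire_space.
HB.instance Definition _ := Uniform.on baire_space.

(* The monoid S^-_oo; set_type carries the subspace topology. *)
Definition inj_monoid : Type :=
  set_type [set f : baire_space | injective f].

HB.instance Definition _ := Choice.on inj_monoid.
HB.instance Definition _ := Topological.on inj_monoid.

Definition inj_fun (g : inj_monoid) : nat -> nat := set_val g.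

Lemma inj_fun_inj (g : inj_monoid) : injective (inj_fun g).
Proof. exact: (set_mem (valP g)). Qed.

Definition inj_mk (f : nat -> nat) (fI : injective f) : inj_monoid :=
  exist _ (f : baire_space) (mem_set fI).

Lemma inj_monoid_ext (g h : inj_monoid) : inj_fun g =1 inj_fun h -> g = h.
Proof. by move=> /funext gh; exact: val_inj. Qed.

Definition inj_one : inj_monoid := inj_mk (@inj_id nat).

Definition inj_mul (g h : inj_monoid) : inj_monoid :=
  inj_mk (inj_comp (@inj_fun_inj g) (@inj_fun_inj h)).

Lemma inj_mulA : associative inj_mul.
Proof. by move=> f g h; exact: inj_monoid_ext. Qed.

Lemma inj_mul1g : left_id inj_one inj_mul.
Proof. by move=> g; exact: inj_monoid_ext. Qed.

Lemma inj_mulg1 : right_id inj_one inj_mul.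
Proof. by move=> g; exact: inj_monoid_ext. Qed.

HB.instance Definition _ := isPointed.Build inj_monoid inj_one.
HB.instance Definition _ :=
  isMonoid.Build inj_monoid inj_mulA inj_mul1g inj_mulg1.

Lemma inj_fun1 n : inj_fun 1%g n = n.
Proof. by []. Qed.

Lemma inj_funM (g h : inj_monoid) n :
  inj_fun (g * h)%g n = inj_fun g (inj_fun h n).
Proof. by []. Qed.

(* A topological space regarded as a measurable space, with its Borel sets. *)
Notation borel T := (g_sigma_algebraType (@open T)).

Definition polish_metric (K : realType) (T : metricType K) : Prop :=
  (exists2 D : set T, countable D & dense D) /\
  (forall F : set_system T, ProperFilter F -> cauchy F ->
     exists x : T, F --> x).

(* The sigma-algebra of X is the Borel sigma-algebra of some Polish topology;
   f carries that topology over from T to X.  Every measurableType is pointed,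
   hence X is nonempty. *)
Definition standard_borel (K : realType) (d : measure_display)
    (X : measurableType d) : Prop :=
  exists (T : metricType K) (f : X -> T),
    [/\ polish_metric T, bijective f &
        forall B : set T, <<s @open T >> B <-> measurable (f @^-1` B)].

(* The projections of Borel subsets of X * baire_space. *)
Definition analytic (d : measure_display) (X : measurableType d)
    (A : set X) : Prop :=
  exists2 B : set (X * borel baire_space), measurable B & A = fst @` B.

Definition borel_reducible (d d' : measure_display)
    (X : measurableType d) (Y : measurableType d')
    (R : X -> X -> Prop) (S : Y -> Y -> Prop) : Prop :=
  exists2 f : X -> Y, measurable_fun setT f &
    forall x y, R x y <-> S (f x) (f y).

Definition borel_equivalent (d d' : measure_display)
    (X : measurableType d) (Y : measurableType d')
    (R : X -> X -> Prop) (S : Y -> Y -> Prop) : Prop :=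
  borel_reducible R S /\ borel_reducible S R.

Definition is_action (G : monoidType) (Y : Type) (A : set (G * Y * Y)) : Prop :=
  (forall x, A (1%g, x, x)) /\
  (forall x y z g h, A (h, x, y) -> A (g, y, z) -> A ((g * h)%g, x, z)).

Definition closed_action (A : set (inj_monoid * cantor_space * cantor_space)) :
    Prop :=
  is_action A /\ closed A.

Definition borel_action (d : measure_display) (Y : measurableType d)
    (A : set (inj_monoid * Y * Y)) : Prop :=
  is_action A /\ measurable (A : set (borel inj_monoid * Y * Y)).

Definition induced_qo (G Y : Type) (A : set (G * Y * Y)) (x y : Y) : Prop :=
  exists g, A (g, x, y).

(* Main.v *)
Require Import Defs.
From mathcomp Require Import lra.

(** Coding points of X by the basic balls that contain them gives a Borel map
    e : X -> 2^w with a Borel left inverse h, so R is Borel equivalent to its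
    pullback R' along h, and any closed action inducing R' pulls back along e
    to a Borel action inducing R.  It remains to induce R' by a closed action.
    Borel sets being projections of closed sets, R' x y holds iff some w in a
    closed set of witnesses has source x and target y.  Finite words of
    elements of Baire space embed as a closed submonoid of S^-_oo, and the
    action relates x to y by a word whose letters are witnesses forming a
    chain from x to y; as R' is reflexive and transitive, this induces R'. *)

Set Implicit Arguments.
Unset Strict Implicit.
Unset Printing Implicit Defensive.

Import Order.TTheory GRing.Theory Num.Theory.

Local Open Scope classical_set_scope.

(** * Spaces with a countable clopen base *)

Lemma continuous_coord (I : Type) (K : I -> topologicalType)
    (S : topologicalType) (f : S -> prod_topology K) :
  (forall i, continuous (fun x => f x i)) -> continuous f.
Proof.
move=> cf x; apply/cvg_sup => i U [_ [[W oW <-] Wx WU]].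
by apply: filterS WU _; apply: (cf i x); exact: open_nbhs_nbhs.
Qed.

Lemma continuous_discrete (K : discreteTopologicalType) (T : topologicalType)
    (f : K -> T) : continuous f.
Proof. by apply/continuousP => A _; exact: discrete_open. Qed.

Lemma closed_eq_discrete (K : discreteTopologicalType) (S : topologicalType)
    (f g : S -> K) :
  continuous f -> continuous g -> closed [set x | f x = g x].
Proof.
move=> cf cg; rewrite -openC openE => x /= fgx.
have nf : nbhs x (f @^-1` [set f x]) by apply: cf; exact: discrete_set1.
have ng : nbhs x (g @^-1` [set g x]) by apply: cg; exact: discrete_set1.
by apply: filterS (filterI nf ng) => y [/= -> ->].
Qed.

Lemma closed_eq_prod (I : eqType) (K : I -> discreteTopologicalType)
    (S : topologicalType) (f g : S -> prod_topology K) :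
  continuous f -> continuous g -> closed [set x | f x = g x].
Proof.
move=> cf cg.
have -> : [set x | f x = g x] = \bigcap_i [set x | f x i = g x i].
  apply/seteqP; split=> [x /= fgx i _ /=|x fgx]; first by rewrite fgx.
  by apply: functional_extensionality_dep => i; exact: fgx.
apply: closed_bigI => i _; apply: closed_eq_discrete => x.
- by apply: (@continuous_comp _ _ _ f (proj i)); [exact: cf|exact: proj_continuous].
- by apply: (@continuous_comp _ _ _ g (proj i)); [exact: cg|exact: proj_continuous].
Qed.

(** Clopen members indexed by [nat] make every open set a countable union of closed sets. *)
Definition clopen_base (T : topologicalType) (B : nat -> set T) : Prop :=
  (forall n, clopen (B n)) /\
  (forall (U : set T) x, open U -> U x -> exists2 n, B n x & B n `<=` U).

Lemma open_bigcup_base (T : topologicalType) (B : nat -> set T) (U : set T) :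
  clopen_base B -> open U -> U = \bigcup_(n in [set n | B n `<=` U]) B n.
Proof.
move=> [_ Bb] oU; apply/seteqP; split=> [x Ux|x [n BnU /BnU //]].
by have [n Bnx BnU] := Bb _ _ oU Ux; exists n.
Qed.

Lemma clopen_base_prod (T1 T2 : topologicalType) (B1 : nat -> set T1)
    (B2 : nat -> set T2) : clopen_base B1 -> clopen_base B2 ->
  clopen_base (fun n => if unpickle n is Some p then B1 p.1 `*` B2 p.2 else set0).
Proof.
move=> [cB1 bB1] [cB2 bB2]; split=> [n|U [x y] oU Uxy].
  case: unpickle => [[i j]|]; last by split; [exact: open0|exact: closed0].
  have -> : B1 i `*` B2 j = fst @^-1` B1 i `&` snd @^-1` B2 j by [].
  apply: clopenI; apply: preimage_clopen => //.
    by move=> ?; exact: cvg_fst.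
  by move=> ?; exact: cvg_snd.
have : nbhs (x, y) U by exact: open_nbhs_nbhs.
case=> -[V W] /= [nV nW] VWU.
move: nV nW; rewrite !nbhsE => -[V' [oV' V'x] V'V] [W' [oW' W'y] W'W].
have [i B1x B1V] := bB1 _ _ oV' V'x; have [j B2y B2W] := bB2 _ _ oW' W'y.
exists (pickle (i, j)); rewrite pickleK //= => -[a b] [/= Ba Bb].
by apply: VWU; split; [exact/V'V/B1V|exact/W'W/B2W].
Qed.

(** The filter generated by the cylinders around [x] converges to [x] in each coordinate, hence in
    the product. *)
Lemma prod_topology_nbhs (K : discreteTopologicalType)
    (U : set (prod_topology (fun _ : nat => K))) x :
  open U -> U x -> exists n, forall y : nat -> K, (forall i, i < n -> y i = x i) -> U y.
Proof.
move=> oU Ux.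
pose F := filter_from [set: nat] (fun n => [set y : nat -> K | forall i, i < n -> y i = x i]).
have FF : Filter F.
  apply: filter_from_filter; first by exists 0.
  move=> m n _ _; exists (maxn m n) => // y /= yx.
  by split=> i im; apply: yx; rewrite leq_max im ?orbT.
have : F --> (x : prod_topology (fun _ : nat => K)).
  apply/cvg_sup => i V [_ [[W oW <-] Wx WV]]; apply: filterS WV _.
  by exists i.+1 => // y /= /(_ i (ltnSn i)) ->.
case/(_ U); first exact: open_nbhs_nbhs.
by move=> n _ nU; exists n => y yx; exact: nU.
Qed.

Lemma clopen_base_prod_topology (K : discreteTopologicalType) (c : K -> nat) :
  injective c ->
  clopen_base (fun n => [set x : prod_topology (fun _ : nat => K) |
    forall i, i < size (CodeSeq.decode n) -> c (x i) = nth 0 (CodeSeq.decode n) i]).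
Proof.
move=> c_inj; split=> [n|U x oU Ux].
  set s := CodeSeq.decode n; elim: (size s) => [|m IHm].
    by rewrite (_ : [set _ | _] = setT); [exact: clopenT|exact/seteqP].
  rewrite (_ : [set _ | _] = [set x | forall i, i < m -> c (x i) = nth 0 s i] `&`
     proj m @^-1` [set a | c a = nth 0 s m]).
    apply: clopenI => //; apply: preimage_clopen; last exact: proj_continuous.
    by split; [exact: discrete_open|exact: discrete_closed].
  apply/seteqP; split=> x /=; first by move=> xs; split=> [i /leqW|]; exact: xs.
  by move=> [xs xm] i; rewrite ltnS leq_eqVlt => /predU1P[->//|]; exact: xs.
have [n nU] := prod_topology_nbhs oU Ux.
exists (CodeSeq.code (mkseq (c \o x) n)).
  by rewrite /= CodeSeq.codeK size_mkseq => i ilt; rewrite nth_mkseq.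
move=> y; rewrite /= CodeSeq.codeK size_mkseq => yx; apply: nU => i ilt.
by apply: c_inj; rewrite yx // nth_mkseq.
Qed.

Definition has_clopen_base (T : topologicalType) : Prop :=
  exists B : nat -> set T, clopen_base B.

Lemma has_clopen_base_prod (T1 T2 : topologicalType) :
  has_clopen_base T1 -> has_clopen_base T2 -> has_clopen_base (T1 * T2)%type.
Proof. by move=> [B1 b1] [B2 b2]; eexists; exact: clopen_base_prod b1 b2. Qed.

Lemma baire_clopen_base : has_clopen_base baire_space.
Proof. by eexists; exact: (@clopen_base_prod_topology nat id). Qed.

Lemma cantor_clopen_base : has_clopen_base cantor_space.
Proof.
by eexists; apply: (@clopen_base_prod_topology bool nat_of_bool); case; case.
Qed.

Lemma inj_monoid_clopen_base : has_clopen_base inj_monoid.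
Proof.
have [B [cB bB]] := baire_clopen_base.
exists (fun n => set_val @^-1` B n); split=> [n|_ x [W oW <-] Wx].
  by apply: preimage_clopen => //; exact: initial_continuous.
by have [n Bx BW] := bB _ _ oW Wx; exists n => // y /BW.
Qed.

(** * Suslin sets and Borel maps *)

(** Unlike in [analytic], the projected set is closed; [borel_suslin] and [suslin_proj] bridge the
    difference. *)
Definition suslin (P : topologicalType) (S : set P) : Prop :=
  exists2 F : set (P * baire_space), closed F &
    forall p, S p <-> exists z, F (p, z).

Lemma continuous_pair (S T1 T2 : topologicalType) (f : S -> T1) (g : S -> T2) :
  continuous f -> continuous g -> continuous (fun x => (f x, g x)).
Proof. by move=> cf cg x; apply: cvg_pair; [exact: cf|exact: cg]. Qed.

Lemma continuous_baire_eval (S : topologicalType) (f : S -> baire_space) i :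
  continuous f -> continuous (fun x => f x i).
Proof.
move=> cf x; apply: (@continuous_comp _ _ _ f (proj i)); first exact: cf.
exact: proj_continuous.
Qed.

Lemma continuous_reindex (S : topologicalType) (f : S -> baire_space)
    (r : nat -> nat) :
  continuous f -> continuous (fun x => (f x \o r : baire_space)).
Proof.
move=> cf; apply: continuous_coord => i.
exact: (continuous_baire_eval (i := r i) cf).
Qed.

Lemma fst_continuous (T U : topologicalType) : continuous (@fst T U).
Proof. by move=> ?; exact: cvg_fst. Qed.

Lemma snd_continuous (T U : topologicalType) : continuous (@snd T U).
Proof. by move=> ?; exact: cvg_snd. Qed.

Lemma closed_suslin (P : topologicalType) (S : set P) : closed S -> suslin S.
Proof.
move=> cS; exists (fst @^-1` S).
  by move: S cS; apply/continuous_closedP; exact: fst_continuous.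
by move=> p; split=> [Sp|[]//]; exists point.
Qed.

(** The value of a witness at 0 selects the index [n], and its shift is a witness for [S n]. *)
Lemma suslin_bigcup (P : topologicalType) (S : nat -> set P) :
  (forall n, suslin (S n)) -> suslin (\bigcup_n S n).
Proof.
move=> sS.
have /choice[F FS] : forall n, exists F : set (P * baire_space),
    closed F /\ forall p, S n p <-> exists z, F (p, z).
  by move=> n; have [F ? ?] := sS n; exists F.
pose shift (q : P * baire_space) : P * baire_space := (q.1, q.2 \o succn).
have cshift : continuous shift.
  apply: continuous_pair; first exact: fst_continuous.
  by apply: continuous_reindex; exact: snd_continuous.
(* The condition on the selected index is written as an implication for every [n], so that the set
   is an intersection of closed ones. *)
exists (\bigcap_n ([set q : P * baire_space | q.2 0 != n] `|` shift @^-1` F n)).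
  apply: closed_bigI => n _; apply: closedU.
    have /continuous_closedP cp : continuous (fun q : P * baire_space => q.2 0).
      by apply: continuous_baire_eval; exact: snd_continuous.
    by apply: (cp [set m | m != n]); exact: discrete_closed.
  by move/continuous_closedP: cshift; apply; have [] := FS n.
move=> p; split=> [[n _ /(FS n).2 [z Fz]]|[z Fz]].
  exists (fun i => if i is j.+1 then z j else n) => m _ /=.
  by have [<-|] := eqVneq n m; [right|left].
exists (z 0) => //; apply/(FS _).2; exists (z \o succn).
by have [/=|//] := Fz (z 0) I; rewrite eqxx.
Qed.

(** One element of Baire space codes a whole sequence of witnesses through the pairing
    [pickle (n, i)]. *)
Lemma suslin_bigcap (P : topologicalType) (S : nat -> set P) :
  (forall n, suslin (S n)) -> suslin (\bigcap_n S n).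
Proof.
move=> sS.
have /choice[F FS] : forall n, exists F : set (P * baire_space),
    closed F /\ forall p, S n p <-> exists z, F (p, z).
  by move=> n; have [F ? ?] := sS n; exists F.
pose slice (n : nat) (q : P * baire_space) : P * baire_space :=
  (q.1, q.2 \o (fun i => pickle (n, i))).
exists (\bigcap_n (slice n @^-1` F n)).
  apply: closed_bigI => n _.
  have /continuous_closedP : continuous (slice n).
    apply: continuous_pair; first exact: fst_continuous.
    by apply: continuous_reindex; exact: snd_continuous.
  by apply; have [] := FS n.
move=> p; split=> [Sp|[z Fz] n _]; last first.
  by apply/(FS n).2; eexists; exact: Fz.
have /choice[z zF] : forall n, exists z, F n (p, z).
  by move=> n; apply/(FS n).2; exact: Sp.
exists (fun m => if unpickle m is Some (n, i) then z n i else 0) => n _ /=.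
rewrite /slice/= (_ : _ \o _ = z n) //.
by apply/funext => i /=; rewrite pickleK.
Qed.

Lemma open_suslin (P : topologicalType) (U : set P) :
  has_clopen_base P -> open U -> suslin U.
Proof.
move=> [B Bb] oU; rewrite (open_bigcup_base Bb oU) bigcup_mkcond.
apply: suslin_bigcup => n; case: ifP => _; apply: closed_suslin.
  by have [] := Bb.1 n.
exact: closed0.
Qed.

(* The sets that are Suslin together with their complement form a sigma-algebra. *)
Lemma borel_suslin (P : topologicalType) (S : set P) :
  has_clopen_base P -> <<s @open P >> S -> suslin S.
Proof.
move=> bP mS.
suff : [set S : set P | suslin S /\ suslin (~` S)] S by case.
move: S mS; apply: smallest_sub => [|U oU]; last first.
  split; first exact: open_suslin.
  by apply: closed_suslin; exact: open_closedC.
split=> [|A [sA sCA]|A sA].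
- by split; apply: closed_suslin; rewrite ?setC0; [exact: closed0|exact: closedT].
- by rewrite setTD; split; rewrite ?setCK.
- split; first by apply: suslin_bigcup => n; have [] := sA n.
  by rewrite setC_bigcup; apply: suslin_bigcap => n; have [] := sA n.
Qed.

(** Only open sets are tested, so [T] may be a product with its product topology. *)
Definition borel_map (d : measure_display) (Z : measurableType d)
    (T : topologicalType) (f : Z -> T) : Prop :=
  forall U, open U -> measurable (f @^-1` U).

Lemma measurable_fun_borelP (d : measure_display) (Z : measurableType d)
    (T : ptopologicalType) (f : Z -> T) :
  measurable_fun setT (f : Z -> borel T) <-> borel_map f.
Proof.
split=> [mf U oU|bf].
  rewrite -[X in measurable X]setTI; apply: mf => //.
  exact: sub_sigma_algebra.
apply: (@measurability _ _ Z (borel T) setT f (@open T)) => //.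
by move=> _ [U oU <-]; rewrite setTI; exact: bf.
Qed.

(** Countable bases make each open set of the product a countable union of rectangles. *)
Lemma borel_map_pair (d : measure_display) (Z : measurableType d)
    (T1 T2 : topologicalType) (f : Z -> T1) (g : Z -> T2) :
  has_clopen_base T1 -> has_clopen_base T2 ->
  borel_map f -> borel_map g -> borel_map (fun z => (f z, g z)).
Proof.
move=> [B1 b1] [B2 b2] bf bg U oU.
rewrite (open_bigcup_base (clopen_base_prod b1 b2) oU) preimage_bigcup.
apply: bigcup_measurable => n _; case: unpickle => [[i j]|/=]; last first.
  by rewrite preimage_set0; exact: measurable0.
rewrite (_ : _ @^-1` _ = f @^-1` B1 i `&` g @^-1` B2 j) //.
by apply: measurableI; [apply: bf|apply: bg]; [have [] := b1.1 i|have [] := b2.1 j].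
Qed.

Lemma borel_map_cantor (d : measure_display) (Z : measurableType d)
    (f : Z -> cantor_space) :
  (forall n, measurable [set z | f z n]) -> borel_map f.
Proof.
move=> mf U oU.
have c_inj : injective nat_of_bool by case; case.
rewrite (open_bigcup_base (clopen_base_prod_topology c_inj) oU) preimage_bigcup.
apply: bigcup_measurable => n _; set s := CodeSeq.decode n.
rewrite (_ : _ @^-1` _ = \bigcap_(i in `I_(size s))
    [set z | nat_of_bool (f z i) = nth 0 s i]).
  apply: bigcap_measurableType => i _; case: (nth 0 s i) => [|[|k]].
  - rewrite (_ : [set _ | _] = ~` [set z | f z i]); first exact: measurableC.
    by apply/seteqP; split=> z /=; case: (f z i).
  - rewrite (_ : [set _ | _] = [set z | f z i]) //.
    by apply/seteqP; split=> z /=; case: (f z i).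
  - rewrite (_ : [set _ | _] = set0) //.
    by apply/seteqP; split=> z //=; case: (f z i).
by apply/seteqP; split.
Qed.

(** Two witnesses are interleaved into one, at the even and at the odd places. *)
Lemma suslin_proj (P : topologicalType) (S : set (P * baire_space)) :
  suslin S -> suslin [set p | exists z, S (p, z)].
Proof.
move=> [F cF SF].
pose split_wit (q : P * baire_space) : P * baire_space * baire_space :=
  (q.1, q.2 \o double, q.2 \o (succn \o double)).
have /continuous_closedP csw : continuous split_wit.
  apply: continuous_pair; first apply: continuous_pair.
  - exact: fst_continuous.
  - by apply: continuous_reindex; exact: snd_continuous.
  - by apply: continuous_reindex; exact: snd_continuous.
exists (split_wit @^-1` F); first exact: csw.
move=> p; split=> [[z /SF[z' Fz]]|[z Fz]]; last first.
  by exists (z \o double); apply/SF; eexists; exact: Fz.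
exists (fun k => if odd k then z' k./2 else z k./2).
rewrite /= /split_wit /= (_ : _ \o double = z); last first.
  by apply/funext => k /=; rewrite odd_double doubleK.
rewrite (_ : _ \o _ = z') //.
by apply/funext => k /=; rewrite odd_double /= uphalf_double.
Qed.

Lemma analytic_pullback_suslin (d : measure_display) (X : measurableType d)
    (h : borel cantor_space -> X) (S : set (X * X)) :
  measurable_fun setT h -> analytic S ->
  suslin [set p : cantor_space * cantor_space | S (h p.1, h p.2)].
Proof.
move=> mh [B mB ->].
(* The domain carries the Borel sets of the product topology, so that [borel_suslin] applies to the
   preimage of [B]. *)
pose hh (q : borel (cantor_space * cantor_space * baire_space)%type) :
  X * X * borel baire_space := (h q.1.1, h q.1.2, q.2).
have mf (T : ptopologicalType) (f : cantor_space * cantor_space * baire_space -> T) :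
    continuous f -> measurable_fun setT
      (f : borel (cantor_space * cantor_space * baire_space)%type -> borel T).
  move=> /continuousP cf; apply/measurable_fun_borelP => U oU.
  by apply: sub_sigma_algebra; exact: cf.
have mhh : measurable_fun setT hh.
  apply: measurable_fun_pair; first apply: measurable_fun_pair.
  - apply: (measurableT_comp mh (mf _ (fun q => q.1.1) _)) => q.
    by apply: (@continuous_comp _ _ _ fst fst); exact: fst_continuous.
  - apply: (measurableT_comp mh (mf _ (fun q => q.1.2) _)) => q.
    apply: (@continuous_comp _ _ _ fst snd); first exact: fst_continuous.
    exact: snd_continuous.
  - by apply: (mf baire_space snd); exact: snd_continuous.
have -> : [set p : cantor_space * cantor_space | (fst @` B) (h p.1, h p.2)] =
    [set p | exists z, (hh @^-1` B) (p, z)].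
  apply/seteqP; split=> [[x y] /= [[q z] Bqz /= qE]|[x y] /= [z Bz]].
    by exists z; rewrite /hh /= -qE.
  by eexists; first exact: Bz.
apply: suslin_proj; apply: borel_suslin.
  apply: has_clopen_base_prod baire_clopen_base.
  exact: has_clopen_base_prod cantor_clopen_base cantor_clopen_base.
by have := mhh measurableT _ mB; rewrite setTI.
Qed.

(** * Words of elements of Baire space as injections *)

(* The word s = w_0 ... w_(n-1) acts on (codes of) nonempty sequences k :: l by
   appending w_0 k, ..., w_(n-1) k.  The head k is never changed, so every w_i
   can be read off from the values at the singletons [:: k]. *)
Definition word_fun (s : seq baire_space) (n : nat) : nat :=
  CodeSeq.code
    (if CodeSeq.decode n is k :: l
     then k :: l ++ [seq w k | w : baire_space <- s] else [::]).

Lemma word_fun_inj s : injective (word_fun s).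
Proof.
move=> m n /(can_inj CodeSeq.codeK) mn; apply: (can_inj CodeSeq.decodeK).
case: (CodeSeq.decode m) (CodeSeq.decode n) mn => [|k l] [|k' l'] //=.
move=> [-> e].
(* Both appended blocks now come from the same head and the same [s], so they coincide and can be
   cut off. *)
have sl : size l = size l' by move/(congr1 size): e; rewrite !size_cat !size_map => /addIn.
by move/eqP: e; rewrite eqseq_cat // eqxx andbT => /eqP ->.
Qed.

(** Since [s] leaves the head alone, [t] appends the same values after [s] as it would without it.
    Concatenation is thus composition in reverse order. *)
Lemma word_fun_cat s t n : word_fun (s ++ t) n = word_fun t (word_fun s n).
Proof.
rewrite /word_fun CodeSeq.codeK; case: (CodeSeq.decode n) => [//|k l].
by rewrite map_cat catA.
Qed.

Lemma word_fun_nil n : word_fun [::] n = n.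
Proof.
rewrite /word_fun -[RHS]CodeSeq.decodeK.
by case: (CodeSeq.decode n) => [//|k l]; rewrite cats0.
Qed.

(** Index [i.+1] skips the head. On an injection that is not a word the value is meaningless, but
    still continuous in [g]. *)
Definition letter (g : inj_monoid) (i : nat) : baire_space :=
  fun k => nth 0 (CodeSeq.decode (inj_fun g (CodeSeq.code [:: k]))) i.+1.

Definition word_length (g : inj_monoid) : nat :=
  (size (CodeSeq.decode (inj_fun g (CodeSeq.code [:: 0])))).-1.

Lemma word_length_word g s : inj_fun g =1 word_fun s -> word_length g = size s.
Proof.
by move=> gs; rewrite /word_length gs /word_fun !CodeSeq.codeK /= size_map.
Qed.

Lemma mkseq_letter g s : inj_fun g =1 word_fun s -> mkseq (letter g) (size s) = s.
Proof.
move=> gs; apply: (@eq_from_nth _ point); rewrite size_mkseq // => i ilt.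
rewrite nth_mkseq //; apply/funext => k.
by rewrite /letter gs /word_fun !CodeSeq.codeK /= (nth_map point).
Qed.

Lemma continuous_inj_fun n : continuous (fun g : inj_monoid => inj_fun g n).
Proof. by apply: continuous_baire_eval; exact: initial_continuous. Qed.

Lemma continuous_letter i : continuous (fun g => letter g i).
Proof.
apply: continuous_coord => k x.
apply: (@continuous_comp _ _ _ (fun g : inj_monoid => inj_fun g (CodeSeq.code [:: k]))
  (fun v => nth 0 (CodeSeq.decode v) i.+1)).
  exact: continuous_inj_fun.
exact: continuous_discrete.
Qed.

Lemma continuous_word_length : continuous word_length.
Proof.
move=> x; apply: (@continuous_comp _ _ _ (fun g : inj_monoid => inj_fun g (CodeSeq.code [:: 0]))
  (fun v => (size (CodeSeq.decode v)).-1)).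
  exact: continuous_inj_fun.
exact: continuous_discrete.
Qed.

Lemma closed_word n :
  closed [set g : inj_monoid | inj_fun g =1 word_fun (mkseq (letter g) n)].
Proof.
have -> : [set g : inj_monoid | inj_fun g =1 word_fun (mkseq (letter g) n)] =
   \bigcap_m [set g : inj_monoid | inj_fun g m = word_fun (mkseq (letter g) n) m].
  apply/seteqP; split=> [g gn m _|g gn m]; last exact: gn.
  exact: gn.
apply: closed_bigI => m _; apply: closed_eq_discrete.
  exact: continuous_inj_fun.
rewrite /word_fun; case: (CodeSeq.decode m) => [|k l].
  exact: cst_continuous.
(* The right side depends on [g] only through its value at the singleton [k], hence factors through
   a discrete space. *)
pose phi v := CodeSeq.code (k :: l ++
  mkseq (fun i => nth 0 (CodeSeq.decode v) i.+1) n).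
move=> x; rewrite (_ : (fun g => _) =
    phi \o (fun g : inj_monoid => inj_fun g (CodeSeq.code [:: k]))); last first.
  by apply/funext => g /=; rewrite -map_comp.
apply: continuous_comp; first exact: continuous_inj_fun.
exact: continuous_discrete.
Qed.

(** * The action by chains of witnesses *)

Section chain_action.
Variables (F : set baire_space) (src tgt : baire_space -> cantor_space).

Fixpoint chain (s : seq baire_space) (x y : cantor_space) : Prop :=
  if s is w :: s' then [/\ src w = x, F w & chain s' (tgt w) y] else x = y.

Lemma chain_cat s t x y z : chain s x y -> chain t y z -> chain (s ++ t) x z.
Proof. by elim: s x => [x -> //|w s IHs x /= [? ? /IHs wz] /wz]. Qed.

(** The injection determines [s]; quantifying over [s] makes the action laws immediate, while
    closedness is proved by decoding it. *)
Definition chain_action : set (inj_monoid * cantor_space * cantor_space) :=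
  [set t | exists2 s, inj_fun t.1.1 =1 word_fun s & chain s t.1.2 t.2].

Lemma is_action_chain : is_action chain_action.
Proof.
split=> [x|x y z g h [s hs sxy] [t gt tyz]].
  by exists [::] => // n; rewrite word_fun_nil.
exists (s ++ t); last exact: chain_cat tyz.
by move=> n; rewrite word_fun_cat -hs -gt.
Qed.

(** One-letter words give every pair of [R]. Conversely, reflexivity handles the empty word and
    transitivity composes the links of a chain. *)
Lemma induced_chain_action (R : cantor_space -> cantor_space -> Prop) :
  PreOrder R ->
  (forall x y, R x y <-> exists w, [/\ F w, src w = x & tgt w = y]) ->
  forall x y, R x y <-> induced_qo chain_action x y.
Proof.
move=> [R_refl R_trans] RF x y; split=> [/RF[w [Fw wx wy]]|[g [s _ /=]]].
  by exists (inj_mk (@word_fun_inj [:: w])), [:: w].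
elim: s x => [x ->|w s IHs x [wx Fw /IHs]]; first exact: R_refl.
by apply: R_trans; apply/RF; exists w.
Qed.

Hypothesis F_closed : closed F.
Hypothesis src_continuous : continuous src.
Hypothesis tgt_continuous : continuous tgt.

(** Induction on the fixed list [r], with [u] general because each link replaces the source by
    [tgt (L i x)]. A link adds an equation between continuous maps and a preimage of [F], both
    closed. *)
Lemma closed_chain (S : topologicalType) (L : nat -> S -> baire_space)
    (r : seq nat) (u v : S -> cantor_space) :
  (forall i, continuous (L i)) -> continuous u -> continuous v ->
  closed [set x | chain [seq L i x | i <- r] (u x) (v x)].
Proof.
move=> cL + cv; elim: r u => [|i r IHr] u cu /=.
  exact: (@closed_eq_prod nat (fun=> bool)).
rewrite (_ : [set _ | _] = [set x | src (L i x) = u x] `&` L i @^-1` F `&`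
    [set x | chain [seq L i x | i <- r] (tgt (L i x)) (v x)]); last first.
  by apply/seteqP; split=> x /= => [[]|[[]]].
apply: closedI; first apply: closedI.
- apply: (@closed_eq_prod nat (fun=> bool)) => // x.
  by apply: (@continuous_comp _ _ _ (L i) src); [exact: cL|exact: src_continuous].
- by move/continuous_closedP: (cL i); exact.
- apply: IHr => x.
  by apply: (@continuous_comp _ _ _ (L i) tgt); [exact: cL|exact: tgt_continuous].
Qed.

(* The length of a word is a continuous function of the injection, and for a
   fixed length membership is a closed condition on the decoded letters. *)
Lemma closed_chain_action : closed chain_action.
Proof.
have c1 : continuous (fun t : inj_monoid * cantor_space * cantor_space => t.1.1).
  move=> t; apply: (@continuous_comp _ _ _ fst fst); exact: fst_continuous.
have c2 : continuous (fun t : inj_monoid * cantor_space * cantor_space => t.1.2).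
  move=> t; apply: (@continuous_comp _ _ _ fst snd).
    exact: fst_continuous.
  exact: snd_continuous.
(* The choice of a length becomes an intersection of implications, each with the clopen premise that
   the length is [n]. *)
have -> : chain_action = \bigcap_n
   ((fun t => t.1.1) @^-1` (word_length @^-1` [set m | m != n]) `|`
    ((fun t => t.1.1) @^-1` [set g | inj_fun g =1 word_fun (mkseq (letter g) n)] `&`
     [set t | chain [seq letter t.1.1 i | i <- iota 0 n] t.1.2 t.2])).
  apply/seteqP; split=> [[[g x] y] [s /= gs sxy] n _|[[g x] y] gxy].
    have [sn|] := eqVneq (size s) n; last by left; rewrite /= (word_length_word gs).
    by right; rewrite /= -/(mkseq _ _) -sn mkseq_letter.
  have [/=|[/= gw gc]] := gxy (word_length g) I; first by rewrite eqxx.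
  by exists (mkseq (letter g) (word_length g)).
apply: closed_bigI => n _; apply: closedU.
  move/continuous_closedP: (c1); apply.
  move/continuous_closedP: continuous_word_length; apply.
  exact: discrete_closed.
apply: closedI.
  by move/continuous_closedP: (c1); apply; exact: closed_word.
apply: (@closed_chain _ (fun i t => letter t.1.1 i)) => //.
  move=> i t; apply: (@continuous_comp _ _ _ (fun t => t.1.1) (fun g => letter g i)).
    exact: c1.
  exact: continuous_letter.
exact: snd_continuous.
Qed.

End chain_action.

(** * Triples coded by single elements of Baire space *)

Definition code_src (w : baire_space) : cantor_space := fun k => odd (w k).
Definition code_tgt (w : baire_space) : cantor_space := fun k => odd (w k)./2.
Definition code_wit (w : baire_space) : baire_space := fun k => (w k)./2./2.

(** In binary, the two lowest digits hold [x k] and [y k], and the remaining ones hold [z k]. *)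
Definition code_triple (x y : cantor_space) (z : baire_space) : baire_space :=
  fun k => x k + (y k + (z k).*2).*2.

Lemma code_tripleK x y z :
  [/\ code_src (code_triple x y z) = x, code_tgt (code_triple x y z) = y &
      code_wit (code_triple x y z) = z].
Proof.
by split; apply/funext => k; rewrite /code_src /code_tgt /code_wit /code_triple;
  rewrite ?half_bit_double // oddD odd_double addbF oddb.
Qed.

Lemma continuous_recode (K : discreteTopologicalType) (phi : nat -> K) :
  continuous ((fun w k => phi (w k)) :
    baire_space -> prod_topology (fun _ : nat => K)).
Proof.
apply: continuous_coord => k x.
apply: (@continuous_comp _ _ _ (fun w : baire_space => w k) phi).
  by apply: (@continuous_baire_eval _ idfun k) => w; exact: cvg_id.
exact: continuous_discrete.
Qed.

Lemma suslin_closed_action (R : cantor_space -> cantor_space -> Prop) :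
  PreOrder R -> suslin [set p : cantor_space * cantor_space | R p.1 p.2] ->
  exists2 A, closed_action A & forall x y, R x y <-> induced_qo A x y.
Proof.
move=> R_qo [C cC RC].
have csrc : continuous code_src := @continuous_recode bool odd.
have ctgt : continuous code_tgt := @continuous_recode bool (fun n => odd n./2).
have cwit : continuous code_wit := @continuous_recode nat (fun n => n./2./2).
(* An element of Baire space is read as a source, a target and a witness that [R] relates them. *)
pose F := (fun w => (code_src w, code_tgt w, code_wit w)) @^-1` C.
have cF : closed F.
  move/continuous_closedP: (continuous_pair (continuous_pair csrc ctgt) cwit).
  exact.
exists (chain_action F code_src code_tgt).
  by split; [exact: is_action_chain|exact: closed_chain_action].
apply: induced_chain_action => // x y; split.
  move=> /(RC (x, y))[z Cz]; exists (code_triple x y z).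
  by rewrite /F /=; have [-> -> ->] := code_tripleK x y z.
by move=> [w [Fw <- <-]]; apply/(RC (_, _)); exists (code_wit w).
Qed.

(** * Borel retraction of the Cantor space onto a Polish space *)

Section polish_coding.
Local Open Scope ring_scope.
Variables (K : realType) (T : metricType K).

(* [metric_sym] and [metric_triangle] see [T] over a [realFieldType]; these
   instances keep [mdist] syntactically the one of the context, as [lra] needs. *)
Lemma mdistC (x y : T) : mdist x y = mdist y x.
Proof. exact: metric_sym. Qed.

Lemma mdist_triangle (x y z : T) : mdist x z <= mdist x y + mdist y z.
Proof. exact: metric_triangle. Qed.

Lemma open_mdist_lt (a : T) (e : K) : open [set x | mdist x a < e].
Proof.
rewrite openE => x /= xa; apply/nbhs_ballP; exists (e - mdist x a) => /=.
  by rewrite subr_gt0.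
rewrite ballEmdist => y /= xy; have := mdist_triangle y x a.
by rewrite (mdistC y x) => /le_lt_trans; apply; lra.
Qed.

Local Definition radius (m : nat) : K := m.+1%:R^-1.

Lemma radius_gt0 m : 0 < radius m.
Proof. by rewrite invr_gt0 ltr0n. Qed.

Lemma radius_lt (e : K) : 0 < e ->
  exists N, forall k, (N <= k)%N -> radius k < e.
Proof.
move=> e0; have [N _ Ne] := near_infty_natSinv_lt (PosNum e0).
by exists N => k /Ne.
Qed.

(** The factor 2 arises when both points lie within [radius m] of a common centre. *)
Lemma mdist_le_radius (x y : T) : (forall m, mdist x y <= 2 * radius m) -> x = y.
Proof.
move=> xy; apply: mdist_positivity; apply/eqP; rewrite eq_le mdist_ge0 andbT.
apply/ler_addgt0Pl => e e0; have [|N Ne] := @radius_lt (e / 2); first by lra.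
by have := Ne _ (leqnn N); have := xy N; lra.
Qed.

Variable a : nat -> T.
Hypothesis a_dense : forall x (e : K), 0 < e -> exists n, mdist x (a n) < e.
Hypothesis T_complete : forall F : set_system T, ProperFilter F -> cauchy F ->
  exists x : T, F --> x.

(* Bit <n, m> of the code of x says whether x lies within radius m of a n. *)
Definition polish_code (x : T) : cantor_space := fun k =>
  if unpickle k is Some (n, m) then mdist x (a n) < radius m else false.

Definition in_code (u : cantor_space) (n m : nat) : bool := u (pickle (n, m)).

Lemma in_polish_code x n m :
  in_code (polish_code x) n m = (mdist x (a n) < radius m).
Proof. by rewrite /in_code /polish_code pickleK. Qed.

(** Only distances between centres occur, so this is a countable combination of conditions on bits;
    by completeness it still ensures that a point is coded. *)
Definition coherent (u : cantor_space) : Prop :=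
  (forall m, exists n, in_code u n m) /\
  (forall n m n' m', in_code u n m -> in_code u n' m' ->
     mdist (a n) (a n') <= radius m + radius m').

(** The inequality is weak, unlike in [polish_code], so that it survives limits. *)
Definition coded_by (u : cantor_space) (x : T) : Prop :=
  forall n m, in_code u n m -> mdist x (a n) <= radius m.

Lemma coherent_polish_code x : coherent (polish_code x).
Proof.
split=> [m|n m n' m']; rewrite ?in_polish_code.
  have [|n xn] := @a_dense x (radius m); first exact: radius_gt0.
  by exists n; rewrite in_polish_code.
move=> xn xn'; have := mdist_triangle (a n) x (a n').
by rewrite (mdistC (a n) x); lra.
Qed.

Lemma coded_by_polish_code x : coded_by (polish_code x) x.
Proof. by move=> n m; rewrite in_polish_code => /ltW. Qed.

Lemma coded_by_unique u x y :
  coherent u -> coded_by u x -> coded_by u y -> x = y.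
Proof.
move=> [u_ex _] ux uy; apply: (mdist_le_radius) => m.
have [n unm] := u_ex m; have := mdist_triangle x (a n) y.
have := ux _ _ unm; have := uy _ _ unm; rewrite (mdistC y).
by lra.
Qed.

(** One centre is chosen per radius. Coherence makes these centres a Cauchy sequence, and its bounds
    pass to the limit [x]. *)
Lemma coded_by_ex u : coherent u -> exists x, coded_by u x.
Proof.
move=> [u_ex u_coh]; have /choice[n_ un] := u_ex.
have [|x yx] := @T_complete ((a \o n_) @ \oo) _.
  apply: cauchy_exP => e e0; have [|N Ne] := @radius_lt (e / 2); first by lra.
  exists (a (n_ N)); exists N => // k /= Nk; rewrite ballEmdist /=.
  have := u_coh _ _ _ _ (un N) (un k); have := Ne _ (leqnn N); have := Ne _ Nk.
  by lra.
exists x => n m unm; apply/ler_addgt0Pl => e e0.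
have [|N Ne] := @radius_lt (e / 2); first by lra.
have : ((a \o n_) @ \oo) (ball x (e / 2)).
  by apply: yx; apply: nbhsx_ballx; rewrite divr_gt0.
move=> [M _ Mx]; pose k := maxn N M.
have := Mx k (leq_maxr _ _); rewrite /= ballEmdist /=.
have := Ne k (leq_maxl _ _); have := u_coh _ _ _ _ (un k) unm.
have := mdist_triangle x (a (n_ k)) (a n).
by lra.
Qed.

Variable x0 : T.

Definition polish_decode (u : cantor_space) : T :=
  if pselect (coherent u) then xget x0 (coded_by u) else x0.

Lemma polish_decodeP u : coherent u -> coded_by u (polish_decode u).
Proof.
move=> cu; rewrite /polish_decode; case: pselect => // ? /=.
have [x ux] := coded_by_ex cu; exact: (xgetI x0 ux).
Qed.

Lemma polish_codeK : cancel polish_code polish_decode.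
Proof.
move=> x; have cx := coherent_polish_code x.
exact: (coded_by_unique cx (polish_decodeP cx) (@coded_by_polish_code x)).
Qed.

Lemma measurable_in_code n m :
  measurable ([set u | in_code u n m] : set (borel cantor_space)).
Proof.
apply: sub_sigma_algebra.
have /continuousP : continuous (fun u : cantor_space => u (pickle (n, m))).
  move=> u; exact: (@proj_continuous nat (fun=> bool) (pickle (n, m)) u).
by move=> /(_ [set b : bool | b]); apply; exact: discrete_open.
Qed.

Lemma measurable_coherent : measurable (coherent : set (borel cantor_space)).
Proof.
rewrite (_ : coherent = (\bigcap_m \bigcup_n [set u | in_code u n m]) `&`
  (\bigcap_n \bigcap_m \bigcap_n' \bigcap_m'
    [set u | in_code u n m -> in_code u n' m' ->
       mdist (a n) (a n') <= radius m + radius m'])); last first.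
  apply/seteqP; split=> [u [u_ex u_coh]|u [u_ex u_coh]].
    split=> [m _|n _ m _ n' _ m' _]; last exact: u_coh.
    by have [n un] := u_ex m; exists n.
  split=> [m|n m n' m']; first by have [n _ un] := u_ex m I; exists n.
  exact: (u_coh n I m I n' I m' I).
apply: measurableI.
  apply: bigcap_measurableType => m _; apply: bigcup_measurable => n _.
  exact: measurable_in_code.
apply: bigcap_measurableType => n _; apply: bigcap_measurableType => m _.
apply: bigcap_measurableType => n' _; apply: bigcap_measurableType => m' _.
(* For fixed indices the inequality is a constant: if true, the condition is void; if false, the two
   bits may not both be set. *)
case: (mdist _ _ <= _).
  rewrite (_ : [set _ | _] = setT); last exact/seteqP.
  exact: measurableT.
rewrite (_ : [set _ | _] =
    ~` ([set u | in_code u n m] `&` [set u | in_code u n' m'])); last first.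
  apply/seteqP; split=> u /= uN; first by move=> [/uN + /[dup]] => /[apply].
  by move=> unm un'm'; exfalso; exact: uN.
by apply: measurableC; apply: measurableI; exact: measurable_in_code.
Qed.

(** Doubling the radius turns the weak bound of [coded_by] into a strict one, which puts the decoded
    point into the ball. *)
Lemma polish_decode_open u (U : set T) : coherent u -> open U ->
  U (polish_decode u) <-> exists n m, in_code u n m /\
    [set x | mdist x (a n) < 2 * radius m] `<=` U.
Proof.
move=> cu oU; have ud := polish_decodeP cu; split; last first.
  move=> [n [m [unm]]]; apply => /=; have := ud _ _ unm.
  have := radius_gt0 m.
  by lra.
move=> Uu; have : nbhs (polish_decode u) U by exact: open_nbhs_nbhs.
case/nbhs_ballP => e /= e0; rewrite ballEmdist => eU.
(* The decoded point is within [radius N] of the centre and [y] within twice that, hence the third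
   of [e]. *)
have [|N Ne] := @radius_lt (e / 3); first by lra.
have [n un] := cu.1 N; exists n, N; split=> // y /= yn; apply: eU => /=.
have := mdist_triangle (polish_decode u) (a n) y; rewrite (mdistC (a n)).
have := ud _ _ un; have := Ne _ (leqnn N).
by lra.
Qed.

Lemma measurable_polish_decode (B : set T) : <<s @open T >> B ->
  measurable (polish_decode @^-1` B : set (borel cantor_space)).
Proof.
move: B; apply: smallest_sub => [|U oU].
  split=> /= [|A mA|A mA].
  - by rewrite preimage_set0; exact: measurable0.
  - by rewrite setTD preimage_setC; exact: measurableC.
  - by rewrite preimage_bigcup; exact: bigcup_measurable.
rewrite /=.
(* All incoherent sequences decode to [x0], so they are added exactly when [x0] lies in [U]. *)
rewrite (_ : _ @^-1` _ = (coherent `&` \bigcup_n \bigcup_(m in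
    [set m | [set x | mdist x (a n) < 2 * radius m] `<=` U])
    [set u | in_code u n m]) `|` (if x0 \in U then ~` coherent else set0)).
  apply: measurableU.
    apply: measurableI; first exact: measurable_coherent.
    apply: bigcup_measurable => n _; apply: bigcup_measurable => m _.
    exact: measurable_in_code.
  case: ifP => _; last exact: measurable0.
  by apply: measurableC; exact: measurable_coherent.
apply/seteqP; split=> u /=.
  have [cu|ncu] := pselect (coherent u).
    move=> /(polish_decode_open cu oU)[n [m [unm nmU]]]; left; split=> //.
    by exists n => //; exists m.
  rewrite /polish_decode; case: pselect => // ? /= Ux0; right.
  by rewrite mem_set.
move=> [[cu [n _ [m nmU unm]]]|].
  by apply/(polish_decode_open cu oU); exists n, m.
case: ifPn => // /set_mem Ux0 ncu.
by rewrite /polish_decode; case: pselect.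
Qed.

End polish_coding.

Lemma standard_borel_cantor_retract (K : realType) (d : measure_display)
    (X : measurableType d) : standard_borel K X ->
  exists (e : X -> borel cantor_space) (h : borel cantor_space -> X),
    [/\ measurable_fun setT e, measurable_fun setT h & cancel e h].
Proof.
move=> [T [f [[[D cD dD] Tc] [g fK gK] fB]]].
(* The dense set is nonempty because [X] is pointed, so some [a] enumerates it. *)
have [D0|[a]] := pfcard_geP cD.
  have [|x] := dD setT _ openT; first by exists (f point).
  by rewrite D0 => -[].
have a_dense x (e : K) : (0 < e)%R -> exists n, (mdist x (a n) < e)%R.
  move=> e0; have [||y [yx Dy]] := dD [set y | (mdist y x < e)%R].
  - by exists x; rewrite /= mdistxx.
  - exact: open_mdist_lt.
  have [n _ ny] := @surj _ _ _ _ a _ Dy.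
  by exists n; rewrite ny mdistC.
exists (polish_code a \o f), (g \o polish_decode a (f point)); split.
- apply/measurable_fun_borelP; apply: borel_map_cantor => k /=; apply/(fB [set x | polish_code a x k]).
  apply: sub_sigma_algebra; rewrite /polish_code; case: unpickle => [[n m]|].
    exact: open_mdist_lt.
  by rewrite (_ : [set _ | _] = set0); [exact: open0|by apply/seteqP; split].
- move=> _ E mE; rewrite setTI comp_preimage.
  apply: measurable_polish_decode => //; apply/fB.
  rewrite (_ : f @^-1` _ = E) //; apply/seteqP.
  by split=> x /=; rewrite fK.
- by move=> x /=; rewrite polish_codeK.
Qed.

Theorem theorem3p19 (K : realType) (d : measure_display) (X : measurableType d)
    (hX : standard_borel K X) (R : X -> X -> Prop) (R_qo : PreOrder R)
    (R_analytic : analytic [set p : X * X | R p.1 p.2]) :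
  (exists2 A : set (inj_monoid * cantor_space * cantor_space),
     closed_action A &
     @borel_equivalent _ _ X (borel cantor_space) R (induced_qo A)) /\
  (exists2 A : set (inj_monoid * X * X),
     borel_action A &
     forall x y, R x y <-> induced_qo A x y).
Proof.
have [e [h [me mh eK]]] := standard_borel_cantor_retract hX.
pose R' (x y : cantor_space) := R (h x) (h y).
have R'_qo : PreOrder R'.
  by have [Rr Rt] := R_qo; split=> [x|x y z]; [exact: Rr|exact: Rt].
have [A [aA cA] RA] :=
  suslin_closed_action R'_qo (analytic_pullback_suslin mh R_analytic).
have RE x y : R x y <-> induced_qo A (e x) (e y).
  by rewrite -RA /R' !eK.
split.
  (* The map [e] reduces [R] because [h] inverts it; [h] reduces the induced quasi-order by the
     definition of [R']. *)
  by exists A => //; split; [exists e|exists h => // x y; rewrite -RA].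
(* The monoid coordinate is untouched, so the action laws pull back along [ee]. *)
pose ee (t : borel inj_monoid * X * X) :
  inj_monoid * cantor_space * cantor_space := (t.1.1, e t.1.2, e t.2).
have bee : borel_map ee.
  apply: borel_map_pair cantor_clopen_base _ _.
  - exact: has_clopen_base_prod inj_monoid_clopen_base cantor_clopen_base.
  - apply: borel_map_pair inj_monoid_clopen_base cantor_clopen_base _ _.
    + apply/(@measurable_fun_borelP _ _ inj_monoid); exact: measurableT_comp.
    + apply/(@measurable_fun_borelP _ _ cantor_space).
      by apply: (measurableT_comp me); exact: measurableT_comp.
  - by apply/(@measurable_fun_borelP _ _ cantor_space); exact: measurableT_comp.
exists (ee @^-1` A); last by move=> x y; rewrite RE.
split.
  have [A1 AM] := aA; split=> [x|x y z g k]; first exact: A1.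
  exact: AM.
by have := measurableC (bee _ (closed_openC cA)); rewrite -preimage_setC setCK.
Qed.
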